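(* Let $f$ be the metric coefficient of a spacetime in class $\mathcal{S}_{\text{ext}}$, $v(r):=f(r)/r^2$, and let $\lambda^2>\lambda_*^2:=v(r_* )$. Consider the photon surface ODE $$\Big(\frac{dr}{dt}\Big)^2=\frac{f(r)^2\,(\lambda^2r^2-f(r))}{\lambda^2r^2}.\qquad(\ast)$$ There exists a smooth, strictly increasing, global solution $r_\lambda$ of $(\ast)$ with this $\lambda^2$ and range $r_\lambda(\mathbb{R})=(r_H,\infty)$ such that the following holds: For any initial value $r_H<r_0<\infty$, there exist precisely two smooth, global solutions $r^\pm_{r_0}$ of $(\ast)$ with this $\lambda^2$ and initial value $r(0)=r_0$; these are time-reflections of each other and $r^+_{r_0}$ is a time-translation of $r_\lambda$. Solving the initial value problem for $(\ast)$ at generic $t_0$ rather than at $t_0=0$ results only in further time-translations. Here, uniqueness is meant locally in comparison with other local $C^1$-solutions. The solutions $r^\pm_{r_0}$ behave as follows: $r^+_{r_0}$ is strictly increasing, tends to $r_H$ as $t\to-\infty$ and to $\infty$ as $t\to\infty$, while $r^-_{r_0}$ is strictly decreasing, tends to $\infty$ as $t\to-\infty$ and to $r_H$ as $t\to\infty$.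
   Context: Class $\mathcal{S}$: Lorentzian manifolds $(\mathbb{R}\times\mathcal{I}\times\mathbb{S}^{n-1},\ -f(r)dt^2+\frac{1}{f(r)}dr^2+r^2\Omega)$ with $\mathcal{I}\subseteq(0,\infty)$ an open interval, $f\colon\mathcal{I}\to(0,\infty)$ smooth (the metric coefficient), $\Omega$ the round metric on $\mathbb{S}^{n-1}$. Class $\mathcal{S}_{\text{ext}}$: those members of $\mathcal{S}$ for which $\mathcal{I}=(r_H,\infty)$ for some $r_H>0$ and: (1) $f$ extends $C^3$ to $r_H$ with $f(r_H)=0$, $f'(r_H)>0$; (2) $f(r)\to1$ and $f'(r)\to0$ as $r\to\infty$; (3) $v(r)=f(r)/r^2$ is strictly increasing on $(r_H,r_* )$ up to one global maximum at some $r_*\in\mathcal{I}$ and then strictly decreasing on $(r_*,\infty)$. Solutions $r=r(t)$ take values in $(r_H,\infty)$; global means defined for all $t\in\mathbb{R}$. A time-translation of a function $r(t)$ is $t\mapsto r(t+c)$, $c\in\mathbb{R}$; its time-reflection is $t\mapsto r(-t)$. *)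

(* Defs.v *)
From Stdlib Require Import Reals.
From Coquelicot Require Import Coquelicot.
Open Scope R_scope.

Definition open_interval (a b : Rbar) (x : R) : Prop := Rbar_lt a x /\ Rbar_lt x b.

Definition whole_line (_ : R) : Prop := True.

Definition strictly_increasing_on (D : R -> Prop) (g : R -> R) : Prop :=
  forall x y, D x -> D y -> x < y -> g x < g y.

Definition strictly_decreasing_on (D : R -> Prop) (g : R -> R) : Prop :=
  forall x y, D x -> D y -> x < y -> g y < g x.

(* For open D only: Coquelicot's derivatives are two-sided. *)
Definition smooth_on (D : R -> Prop) (g : R -> R) : Prop :=
  forall (k : nat) x, D x -> ex_derive_n g k x.

(* Derivative relative to a set; at an end point of an interval it is the
   one-sided derivative. *)
Definition is_derive_within (D : R -> Prop) (g : R -> R) (x l : R) : Prop :=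
  filterlim (fun y => (g y - g x) / (y - x))
    (within (fun y => D y /\ y <> x) (locally x)) (locally l).

Definition continuous_within (D : R -> Prop) (g : R -> R) (x : R) : Prop :=
  filterlim g (within D (locally x)) (locally (g x)).

(* C^k on an interval D that need not be open. *)
Fixpoint Ck_within (k : nat) (D : R -> Prop) (g : R -> R) : Prop :=
  match k with
  | O => forall x, D x -> continuous_within D g x
  | S k' => exists g' : R -> R,
      (forall x, D x -> is_derive_within D g x (g' x)) /\ Ck_within k' D g'
  end.

(* f is the metric coefficient of -f(r) dt^2 + dr^2 / f(r) + r^2 Omega on
   R x (a,b) x S^(n-1).  Only (a,b) and f are recorded: the class puts no
   condition on n, and (a,b), f and n determine the manifold.  The values of f
   outside (a,b) are irrelevant. *)
Definition class_S (a b : Rbar) (f : R -> R) : Prop :=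
  Rbar_le 0 a /\ Rbar_lt a b /\
  smooth_on (open_interval a b) f /\
  (forall r, open_interval a b r -> 0 < f r).

Definition v (f : R -> R) (r : R) : R := f r / r ^ 2.

Definition extends_C3_to_horizon (rH : R) (f : R -> R) : Prop :=
  exists (g : R -> R) (kappa : R),
    (forall r, rH < r -> g r = f r) /\
    Ck_within 3 (fun r => rH <= r) g /\
    g rH = 0 /\
    is_derive_within (fun r => rH <= r) g rH kappa /\ 0 < kappa.

Definition class_S_ext (rH rstar : R) (f : R -> R) : Prop :=
  0 < rH /\
  class_S rH p_infty f /\
  extends_C3_to_horizon rH f /\
  is_lim f p_infty 1 /\
  is_lim (Derive f) p_infty 0 /\
  rH < rstar /\
  strictly_increasing_on (open_interval rH rstar) (v f) /\
  (forall r, rH < r -> r <> rstar -> v f r < v f rstar) /\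
  strictly_decreasing_on (open_interval rstar p_infty) (v f).

Definition solves_photon_ODE (f : R -> R) (rH lambda : R) (J : R -> Prop)
    (r : R -> R) : Prop :=
  forall t, J t ->
    rH < r t /\
    ex_derive r t /\
    (Derive r t) ^ 2 =
      (f (r t)) ^ 2 * (lambda ^ 2 * (r t) ^ 2 - f (r t))
        / (lambda ^ 2 * (r t) ^ 2).

Definition C1_solution (f : R -> R) (rH lambda : R) (J : R -> Prop)
    (r : R -> R) : Prop :=
  solves_photon_ODE f rH lambda J r /\
  (forall t, J t -> continuous (Derive r) t).

Definition smooth_global_solution (f : R -> R) (rH lambda : R)
    (r : R -> R) : Prop :=
  solves_photon_ODE f rH lambda whole_line r /\ smooth_on whole_line r.

Definition time_translate (r : R -> R) (c t : R) : R := r (t + c).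

Definition time_reflect (r : R -> R) (t : R) : R := r (- t).

(* The last clause is local uniqueness: no C^1 solution on any open interval
   around t0, global or not, has the given initial value, except for
   restrictions of rp and rm. *)
Definition precisely_two_solutions (f : R -> R) (rH lambda t0 r0 : R)
    (rp rm : R -> R) : Prop :=
  (smooth_global_solution f rH lambda rp /\ rp t0 = r0) /\
  (smooth_global_solution f rH lambda rm /\ rm t0 = r0) /\
  (exists t, rp t <> rm t) /\
  (forall r, smooth_global_solution f rH lambda r -> r t0 = r0 ->
     (forall t, r t = rp t) \/ (forall t, r t = rm t)) /\
  (forall (a b : Rbar) (r : R -> R),
     open_interval a b t0 ->
     C1_solution f rH lambda (open_interval a b) r -> r t0 = r0 ->
     (forall t, open_interval a b t -> r t = rp t) \/
     (forall t, open_interval a b t -> r t = rm t)).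

(* Main.v *)
(* Put F = f sqrt(1 - v / lambda^2), which is smooth and positive on (rH, oo)
   because v <= v(rstar) < lambda^2.  The equation reads r'^2 = F(r)^2, so r'
   never vanishes and by continuity r' = F(r) throughout or r' = -F(r)
   throughout.  Let G be a primitive of 1/F.  Since F <= f, and f decays
   linearly at rH and is bounded at infinity, G is a bijection from (rH, oo)
   onto R, and every solution satisfies G(r(t)) = G(r0) + (t - t0) or
   G(r(t)) = G(r0) - (t - t0).  Hence r_lambda is the inverse of G, and the two
   solutions are its translates and their reflections. *)

From Pilot Require (* Reals has another open_interval. *)
Import Defs.
From Stdlib Require Import Reals Lra ClassicalEpsilon FunctionalExtensionality.
From Coquelicot Require Import Coquelicot.
Import Defs.
Open Scope R_scope.

(** * Smooth functions on an open set *)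

(** The derivatives are witnesses constrained on [D] only, so the closure rules below follow by
    induction on [n] without any formula for [Derive_n]. *)
Fixpoint times_differentiable (n : nat) (D : R -> Prop) (g : R -> R) : Prop :=
  match n with
  | O => True
  | S n' => exists g' : R -> R,
      (forall x, D x -> is_derive g x (g' x)) /\ times_differentiable n' D g'
  end.

Lemma times_differentiable_ext n D g h :
  open D -> (forall x, D x -> g x = h x) ->
  times_differentiable n D g -> times_differentiable n D h.
Proof.
  intros HD; destruct n as [|n]; [easy|].
  intros E [g' [Hg Hn]]; exists g'; split; [|exact Hn].
  intros x Dx; apply is_derive_ext_loc with g; [|exact (Hg x Dx)].
  apply filter_imp with D; [exact E | exact (HD x Dx)].
Qed.

Lemma times_differentiable_pred n D g :
  times_differentiable (S n) D g -> times_differentiable n D g.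
Proof.
  revert g; induction n as [|n IH]; [easy|].
  intros g [g' [Hg Hn]]; exists g'; split; [exact Hg | exact (IH g' Hn)].
Qed.

Lemma times_differentiable_derive_n n k D g :
  open D -> times_differentiable (n + k) D g ->
  times_differentiable n D (Derive_n g k).
Proof.
  intros HD; revert n; induction k as [|k IH]; intros n H.
  - now rewrite Nat.add_0_r in H.
  - rewrite Nat.add_succ_r in H; destruct (IH (S n) H) as [g' [Hg Hn]].
    apply times_differentiable_ext with g'; [exact HD | | exact Hn].
    intros x Dx; symmetry; exact (is_derive_unique _ _ _ (Hg x Dx)).
Qed.

Lemma smooth_on_iff D g :
  open D -> smooth_on D g <-> forall n, times_differentiable n D g.
Proof.
  intros HD; split; intros H.
  (* The induction needs all orders [k] at once, since the derivative of [Derive_n g k] is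
     [Derive_n g (S k)]. *)
  - intros n; change g with (Derive_n g 0); generalize 0%nat.
    induction n as [|n IH]; intros k; [easy|].
    exists (Derive_n g (S k)); split; [|apply IH].
    intros x Dx; apply Derive_correct; exact (H (S k) x Dx).
  - intros [|k] x Dx; [easy|].
    destruct (times_differentiable_derive_n 1 k D g HD (H (1 + k)%nat)) as [g' [Hg _]].
    exists (g' x); exact (Hg x Dx).
Qed.

Lemma times_differentiable_const n D c : times_differentiable n D (fun _ => c).
Proof.
  revert c; induction n as [|n IH]; intros c; [easy|].
  exists (fun _ => 0); split; [|apply IH].
  intros x _; auto_derive; [easy | ring].
Qed.

Lemma times_differentiable_id n D : times_differentiable n D (fun x => x).
Proof.
  destruct n as [|n]; [easy|].
  exists (fun _ => 1); split; [|apply times_differentiable_const].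
  intros x _; auto_derive; [easy | ring].
Qed.

Lemma times_differentiable_plus n D g h :
  times_differentiable n D g -> times_differentiable n D h ->
  times_differentiable n D (fun x => g x + h x).
Proof.
  revert g h; induction n as [|n IH]; [easy|].
  intros g h [g' [Hg Hg']] [h' [Hh Hh']].
  exists (fun x => g' x + h' x); split; [|exact (IH _ _ Hg' Hh')].
  intros x Dx; exact (is_derive_plus g h x _ _ (Hg x Dx) (Hh x Dx)).
Qed.

Lemma times_differentiable_mult n D g h :
  times_differentiable n D g -> times_differentiable n D h ->
  times_differentiable n D (fun x => g x * h x).
Proof.
  revert g h; induction n as [|n IH]; [easy|].
  intros g h Gn Hn.
  (* The product rule keeps the undifferentiated factors [g] and [h], which enter the induction
     hypothesis at the lower order [n]. *)
  pose proof (times_differentiable_pred _ _ _ Gn) as G0.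
  pose proof (times_differentiable_pred _ _ _ Hn) as H0.
  destruct Gn as [g' [Hg Hg']], Hn as [h' [Hh Hh']].
  exists (fun x => g' x * h x + g x * h' x); split.
  - intros x Dx.
    exact (is_derive_mult g h x _ _ (Hg x Dx) (Hh x Dx) Rmult_comm).
  - apply times_differentiable_plus; apply IH; assumption.
Qed.

Lemma times_differentiable_comp n D E g h :
  (forall x, D x -> E (h x)) ->
  times_differentiable n E g -> times_differentiable n D h ->
  times_differentiable n D (fun x => g (h x)).
Proof.
  intros HE; revert g; induction n as [|n IH]; [easy|].
  intros g [g' [Hg Hg']] Hn.
  pose proof (times_differentiable_pred _ _ _ Hn) as H0.
  destruct Hn as [h' [Hh Hh']].
  exists (fun x => h' x * g' (h x)); split.
  - intros x Dx; exact (is_derive_comp g h x _ _ (Hg _ (HE x Dx)) (Hh x Dx)).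
  - apply times_differentiable_mult; [exact Hh'|].
    exact (IH g' Hg' H0).
Qed.

(** The derivative is again a polynomial in [/ x], so the induction closes on itself; for [sqrt]
    below, it is a composition of [/ x] with [sqrt]. *)
Lemma times_differentiable_inv n :
  times_differentiable n (fun x => 0 < x) (fun x => / x).
Proof.
  induction n as [|n IH]; [easy|].
  exists (fun x => (-1) * (/ x * / x)); split.
  - intros x Dx; auto_derive; [lra | field; lra].
  - apply times_differentiable_mult; [apply times_differentiable_const|].
    apply times_differentiable_mult; exact IH.
Qed.

Lemma times_differentiable_sqrt n :
  times_differentiable n (fun x => 0 < x) sqrt.
Proof.
  induction n as [|n IH]; [easy|].
  exists (fun x => / 2 * / sqrt x); split.
  - intros x Dx; pose proof (sqrt_lt_R0 x Dx).
    auto_derive; [exact Dx | field; lra].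
  - apply times_differentiable_mult; [apply times_differentiable_const|].
    apply times_differentiable_comp with (fun x => 0 < x);
      [exact sqrt_lt_R0 | apply times_differentiable_inv | exact IH].
Qed.

(** Bootstrapping: if [r] is [n] times differentiable, so is its derivative [F (r t)], which gives
    [r] one order more. *)
Lemma times_differentiable_ODE n D E F r :
  (forall n, times_differentiable n E F) ->
  (forall t, D t -> E (r t) /\ is_derive r t (F (r t))) ->
  times_differentiable n D r.
Proof.
  intros HF Hr; induction n as [|n IH]; [easy|].
  exists (fun t => F (r t)); split; [intros t Dt; apply Hr, Dt|].
  apply times_differentiable_comp with E; [intros t Dt; apply Hr, Dt | apply HF | exact IH].
Qed.

(** * Autonomous scalar equations with positive right-hand side *)

Lemma is_derive_continuity_pt g x l : is_derive g x l -> continuity_pt g x.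
Proof.
  intros H; apply continuity_pt_filterlim.
  apply (ex_derive_continuous (V := R_NormedModule)); now exists l.
Qed.

Lemma mean_value g g' a b :
  (forall x, Rmin a b <= x <= Rmax a b -> is_derive g x (g' x)) ->
  exists c, Rmin a b <= c <= Rmax a b /\ g b - g a = g' c * (b - a).
Proof.
  intros H; apply MVT_gen; intros x Hx.
  - apply H; lra.
  - apply is_derive_continuity_pt with (g' x), H, Hx.
Qed.

(** Used to bound the time map from below by explicit primitives, logarithmic near the horizon and
    linear far out. *)
Lemma increment_le g g' h h' a b :
  a <= b ->
  (forall x, a <= x <= b -> is_derive g x (g' x)) ->
  (forall x, a <= x <= b -> is_derive h x (h' x)) ->
  (forall x, a <= x <= b -> g' x <= h' x) ->
  g b - g a <= h b - h a.
Proof.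
  intros Hab Hg Hh Hle.
  destruct (mean_value (fun x => h x - g x) (fun x => h' x - g' x) a b) as [c [Hc E]].
  - rewrite Rmin_left, Rmax_right by exact Hab; intros x Hx.
    exact (is_derive_minus h g x _ _ (Hh x Hx) (Hg x Hx)).
  - rewrite Rmin_left, Rmax_right in Hc by exact Hab.
    specialize (Hle c Hc); nra.
Qed.

Lemma zero_derive_constant g a b :
  (forall x, Rmin a b <= x <= Rmax a b -> is_derive g x 0) -> g b = g a.
Proof.
  intros H; destruct (mean_value g (fun _ => 0) a b H) as [c [_ E]]; lra.
Qed.

(** Up to a constant, [G r] is the time at which the flow of [F] reaches [r]. Surjectivity onto the
    line is what makes solutions global. *)
Definition time_map (F : R -> R) (rH : R) (G : R -> R) : Prop :=
  (forall r, rH < r -> is_derive G r (/ F r)) /\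
  (forall t, exists r, rH < r /\ G r = t).

Lemma primitive_strictly_increasing F rH G :
  (forall r, rH < r -> 0 < F r) ->
  (forall r, rH < r -> is_derive G r (/ F r)) ->
  forall x y, rH < x -> x < y -> G x < G y.
Proof.
  intros Fpos HG x y Hx Hxy.
  destruct (mean_value G (fun r => / F r) x y) as [c [Hc E]].
  - rewrite Rmin_left, Rmax_right by lra; intros z Hz; apply HG; lra.
  - rewrite Rmin_left, Rmax_right in Hc by lra.
    assert (0 < / F c) by (apply Rinv_0_lt_compat, Fpos; lra); nra.
Qed.

(* Linear decay of F at rH makes the integral of 1/F diverge there, and
   boundedness of F makes it diverge at infinity. *)
Lemma time_map_exists F rH K r1 M B :
  (forall r, rH < r -> 0 < F r) ->
  (forall r, rH < r -> continuous F r) ->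
  0 < K -> rH < r1 -> (forall r, rH < r <= r1 -> F r <= K * (r - rH)) ->
  0 < B -> (forall r, M < r -> F r <= B) ->
  exists G, time_map F rH G.
Proof.
  intros Fpos Fcont HK Hr1 Hnear HB Hfar.
  set (G := fun r => RInt (fun x => / F x) r1 r).
  assert (Hcont : forall r, rH < r -> continuous (fun x => / F x) r).
  { intros r Hr; apply continuous_Rinv_comp; [exact (Fcont r Hr)|].
    specialize (Fpos r Hr); lra. }
  assert (HG : forall r, rH < r -> is_derive G r (/ F r)).
  { intros r Hr; apply (is_derive_RInt (fun x => / F x) G r1 r); [|exact (Hcont r Hr)].
    apply filter_imp with (fun x => rH < x); [|exact (open_gt rH r Hr)].
    intros x Hx; apply (RInt_correct (V := R_CompleteNormedModule)).
    apply (ex_RInt_continuous (V := R_CompleteNormedModule)).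
    intros z Hz; apply Hcont.
    assert (rH < Rmin r1 x) by (apply Rmin_glb_lt; assumption); lra. }
  exists G; split; [exact HG|]; intros t.
  pose proof (primitive_strictly_increasing F rH G Fpos HG) as Gincr.
  (* [lo] is chosen so that the comparison function [ln (r - rH) / K] grows by exactly
     [Rabs (G r1 - t) + 1] from [lo] to [r1]; this forces [G lo < t]. *)
  set (s := K * (Rabs (G r1 - t) + 1)).
  set (lo := rH + (r1 - rH) * exp (- s)).
  assert (Hs : 0 < s) by (unfold s; pose proof (Rabs_pos (G r1 - t)); nra).
  assert (He : 0 < exp (- s) < 1).
  { split; [apply exp_pos|]; rewrite <- exp_0; apply exp_increasing; lra. }
  assert (Hlo : rH < lo < r1) by (unfold lo; nra).
  assert (Glo : G lo < t).
  { assert (H : ln (r1 - rH) / K - ln (lo - rH) / K <= G r1 - G lo).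
    { apply (increment_le (fun r => ln (r - rH) / K) (fun r => / (K * (r - rH)))
               G (fun r => / F r)); [lra | | |]; intros r Hr.
      - auto_derive; [lra | field; lra].
      - apply HG; lra.
      - apply Rinv_le_contravar; [apply Fpos | apply Hnear]; lra. }
    replace (lo - rH) with ((r1 - rH) * exp (- s)) in H by (unfold lo; ring).
    rewrite ln_mult, ln_exp in H by (try apply exp_pos; lra).
    replace (ln (r1 - rH) / K - (ln (r1 - rH) + - s) / K)
      with (Rabs (G r1 - t) + 1) in H by (unfold s; field; lra).
    pose proof (Rle_abs (G r1 - t)); lra. }
  (* From [m] on, the bound [B] holds inside the domain, and [hi] is so far out that [r / B] grows
     by [Rabs (t - G m) + 1]. *)
  set (m := Rmax (M + 1) (rH + 1)).
  assert (Hm : M + 1 <= m /\ rH + 1 <= m) by (split; [apply Rmax_l | apply Rmax_r]).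
  set (hi := m + B * (Rabs (t - G m) + 1)).
  assert (Hhi : m < hi) by (unfold hi; pose proof (Rabs_pos (t - G m)); nra).
  assert (Ghi : t < G hi).
  { assert (H : hi / B - m / B <= G hi - G m).
    { apply (increment_le (fun r => r / B) (fun r => / B) G (fun r => / F r));
        [lra | | |]; intros r Hr.
      - auto_derive; [easy | field; lra].
      - apply HG; lra.
      - apply Rinv_le_contravar; [apply Fpos | apply Hfar]; lra. }
    replace (hi / B - m / B) with (Rabs (t - G m) + 1) in H by (unfold hi; field; lra).
    pose proof (Rle_abs (t - G m)); lra. }
  assert (Hlohi : lo < hi).
  (* The points [r1] and [m] come in no known order, so [lo < hi] is deduced from [G lo < t < G hi]
     and monotonicity. *)
  { destruct (Rlt_or_le lo hi) as [|[H|H]]; [assumption | |].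
    - assert (G hi < G lo) by (apply Gincr; lra); lra.
    - rewrite H in Ghi; lra. }
  destruct (Ranalysis5.IVT_interv (fun r => G r - t) lo hi) as [r [Hr E]]; try lra.
  - intros r Hr; apply is_derive_continuity_pt with (/ F r - 0).
    apply (is_derive_minus G (fun _ => t)); [apply HG; lra|].
    apply (is_derive_const (V := R_NormedModule)).
  - exists r; lra.
Qed.

(** Strict monotonicity makes the chosen preimage unique. The mean value theorem turns each
    difference quotient of [rho] into a value of [F] near [rho t], and continuity of [F] gives the
    derivative. *)
Lemma time_map_inverse F rH G :
  (forall r, rH < r -> 0 < F r) ->
  (forall r, rH < r -> continuous F r) ->
  time_map F rH G ->
  exists rho : R -> R,
    (forall t, rH < rho t) /\ (forall t, G (rho t) = t) /\
    (forall r, rH < r -> rho (G r) = r) /\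
    (forall t, is_derive rho t (F (rho t))).
Proof.
  intros Fpos Fcont [HG Gsurj].
  pose proof (primitive_strictly_increasing F rH G Fpos HG) as Gincr.
  set (rho := fun t => proj1_sig (constructive_indefinite_description _ (Gsurj t))).
  assert (Hrho : forall t, rH < rho t /\ G (rho t) = t).
  { intros t; exact (proj2_sig (constructive_indefinite_description _ (Gsurj t))). }
  assert (Glt : forall x y, rH < x -> rH < y -> G x < G y -> x < y).
  { intros x y Hx Hy H; destruct (Rtotal_order x y) as [|[E|E]]; [assumption | |].
    - subst; lra.
    - specialize (Gincr y x Hy E); lra. }
  exists rho; split; [|split; [|split]].
  - intros t; apply Hrho.
  - intros t; apply Hrho.
  - intros r Hr; destruct (Hrho (G r)) as [H1 H2].
    destruct (Rtotal_order (rho (G r)) r) as [E|[E|E]]; [|exact E|].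
    + specialize (Gincr _ _ H1 E); lra.
    + specialize (Gincr _ _ Hr E); lra.
  - intros t; apply is_derive_Reals; intros eps Heps.
    destruct (Hrho t) as [Ht Et].
    assert (Hloc : locally (rho t) (fun x => rH < x /\ Rabs (F x - F (rho t)) < eps)).
    { apply filter_and; [exact (open_gt rH _ Ht)|].
      exact (proj1 (filterlim_locally F (F (rho t))) (Fcont _ Ht) (mkposreal eps Heps)). }
    destruct Hloc as [d Hd]; pose proof (cond_pos d) as dpos.
    (* Halving [d] puts the closed window of radius [e] inside the ball. The [G]-images [lo] and
       [hi] of its ends then limit the time increments [k] that keep [rho (t + k)] in the window. *)
    set (e := d / 2); assert (He : 0 < e < d) by (unfold e; lra).
    assert (Hball : forall x, rho t - e <= x <= rho t + e ->
                      rH < x /\ Rabs (F x - F (rho t)) < eps).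
    { intros x Hx; apply Hd; apply Rabs_def1; unfold minus, plus, opp; simpl; lra. }
    set (lo := G (rho t - e)); set (hi := G (rho t + e)).
    assert (Hlo : lo < t).
    { rewrite <- Et; apply Gincr; [apply Hball|]; lra. }
    assert (Hhi : t < hi).
    { rewrite <- Et at 1; apply Gincr; lra. }
    assert (Hmin : 0 < Rmin (t - lo) (hi - t)) by (apply Rmin_pos; lra).
    exists (mkposreal _ Hmin); intros k k0 Hk; simpl in Hk.
    pose proof (Rmin_l (t - lo) (hi - t)); pose proof (Rmin_r (t - lo) (hi - t)).
    apply Rabs_def2 in Hk.
    destruct (Hrho (t + k)) as [Hs Es].
    assert (rho t - e < rho (t + k)).
    { apply Glt; [apply Hball; lra | exact Hs |]. fold lo; lra. }
    assert (rho (t + k) < rho t + e).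
    { apply Glt; [exact Hs | apply Hball; lra |]. fold hi; lra. }
    destruct (mean_value G (fun r => / F r) (rho t) (rho (t + k))) as [c [Hc E]].
    { intros x Hx; apply HG.
      assert (rH < Rmin (rho t) (rho (t + k))) by (apply Rmin_glb_lt; assumption); lra. }
    assert (Hce : rho t - e <= c <= rho t + e).
    { revert Hc; unfold Rmin, Rmax; destruct Rle_dec; lra. }
    destruct (Hball c Hce) as [Hc1 Hc2].
    specialize (Fpos c Hc1).
    rewrite Es, Et in E.
    assert (E' : rho (t + k) - rho t = F c * k).
    { replace k with (t + k - t) at 2 by ring; rewrite E; field; lra. }
    rewrite E'; replace (F c * k / k) with (F c) by (field; exact k0); exact Hc2.
Qed.

(** * Constancy of sign and uniqueness of solutions on an open interval *)

Lemma open_interval_between (a b : Rbar) x y z :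
  open_interval a b x -> open_interval a b y ->
  Rmin x y <= z <= Rmax x y -> open_interval a b z.
Proof.
  intros [Hx1 Hx2] [Hy1 Hy2]; unfold Rmin, Rmax; destruct Rle_dec; intros Hz;
    split; destruct a as [a| |], b as [b| |]; simpl in *; lra.
Qed.

Lemma no_sign_change (a b : Rbar) g :
  (forall t, open_interval a b t -> continuous g t) ->
  (forall t, open_interval a b t -> g t <> 0) ->
  forall s t, open_interval a b s -> open_interval a b t -> 0 < g s -> 0 < g t.
Proof.
  intros Hc Hn s t Hs Ht Hpos.
  destruct (Rtotal_order 0 (g t)) as [|[E|E]]; [assumption | |].
  { now destruct (Hn t Ht). }
  exfalso; destruct (Rtotal_order s t) as [Hst|[Hst|Hst]].
  (* [IVT_interv] expects a negative value on the left and a positive one on the right, so [g] is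
     negated when [s] comes first. *)
  - destruct (Ranalysis5.IVT_interv (fun x => - g x) s t) as [z [Hz Ez]]; try lra.
    + intros x Hx; apply continuity_pt_opp, continuity_pt_filterlim, Hc.
      apply open_interval_between with s t; try assumption.
      now rewrite Rmin_left, Rmax_right by lra.
    + apply (Hn z); [|lra].
      apply open_interval_between with s t; try assumption.
      now rewrite Rmin_left, Rmax_right by lra.
  - subst; lra.
  - destruct (Ranalysis5.IVT_interv g t s) as [z [Hz Ez]]; try lra.
    + intros x Hx; apply continuity_pt_filterlim, Hc.
      apply open_interval_between with t s; try assumption.
      now rewrite Rmin_left, Rmax_right by lra.
    + apply (Hn z); [|lra].
      apply open_interval_between with t s; try assumption.
      now rewrite Rmin_left, Rmax_right by lra.
Qed.

(* In the time coordinate G(r) the equation r' = e F(r) reads (G o r)' = e. *)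
Lemma autonomous_solution_unique F rH G rho (a b : Rbar) e r t0 c :
  (forall x, rH < x -> 0 < F x) ->
  time_map F rH G -> (forall x, rH < x -> rho (G x) = x) ->
  (forall t, G (rho t) = t) ->
  open_interval a b t0 ->
  (forall t, open_interval a b t -> rH < r t /\ is_derive r t (e * F (r t))) ->
  r t0 = rho c ->
  forall t, open_interval a b t -> r t = rho (c + e * (t - t0)).
Proof.
  intros Fpos [HG _] Hinv Hinv' Ht0 Hr E0 t Ht.
  assert (E : G (r t) - e * t = G (r t0) - e * t0).
  { apply (zero_derive_constant (fun t => G (r t) - e * t) t0 t).
    intros x Hx; destruct (Hr x (open_interval_between a b t0 t x Ht0 Ht Hx)) as [H1 H2].
    replace 0 with ((e * F (r x)) * / F (r x) - e)
      by (specialize (Fpos _ H1); field; lra).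
    apply (is_derive_minus (fun t => G (r t)) (fun t => e * t)).
    - exact (is_derive_comp G r x _ _ (HG _ H1) H2).
    - auto_derive; [easy | ring]. }
  rewrite <- (Hinv (r t)) by apply Hr, Ht.
  f_equal; rewrite E0, Hinv' in E; lra.
Qed.

(** * The photon surface equation *)

Definition photon_speed (f : R -> R) (lambda r : R) : R :=
  f r * sqrt (1 - v f r / lambda ^ 2).

Lemma photon_speed_pos f lambda r :
  0 < f r -> v f r < lambda ^ 2 -> 0 < lambda ^ 2 -> 0 < photon_speed f lambda r.
Proof.
  intros Hf Hv Hl; apply Rmult_lt_0_compat; [exact Hf|]; apply sqrt_lt_R0.
  apply Rlt_0_minus, Rlt_div_l; lra.
Qed.

(** The square root factor is at most 1, so the upper bounds on [f] at the horizon and at infinity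
    carry over to the speed. *)
Lemma photon_speed_le f lambda r :
  0 < f r -> 0 < r -> 0 < lambda ^ 2 -> photon_speed f lambda r <= f r.
Proof.
  intros Hf Hr Hl.
  assert (0 < v f r) by (apply Rdiv_lt_0_compat; [exact Hf | nra]).
  assert (0 < v f r / lambda ^ 2) by (apply Rdiv_lt_0_compat; assumption).
  assert (sqrt (1 - v f r / lambda ^ 2) <= 1)
    by (rewrite <- sqrt_1 at 2; apply sqrt_le_1_alt; lra).
  unfold photon_speed; nra.
Qed.

Lemma photon_speed_sqr f lambda r :
  0 < r -> v f r < lambda ^ 2 -> 0 < lambda ^ 2 ->
  photon_speed f lambda r ^ 2 =
    f r ^ 2 * (lambda ^ 2 * r ^ 2 - f r) / (lambda ^ 2 * r ^ 2).
Proof.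
  intros Hr Hv Hl; unfold photon_speed.
  rewrite Rpow_mult_distr, pow2_sqrt.
  - unfold v; field; split; [lra | intros E; subst; lra].
  - apply Rlt_le, Rlt_0_minus, Rlt_div_l; lra.
Qed.

Lemma photon_speed_times_differentiable n f rH lambda :
  0 <= rH -> 0 < lambda ^ 2 -> smooth_on (fun r => rH < r) f ->
  (forall r, rH < r -> v f r < lambda ^ 2) ->
  times_differentiable n (fun r => rH < r) (photon_speed f lambda).
Proof.
  intros HrH Hl Hf Hv.
  assert (Hfn := proj1 (smooth_on_iff _ f (open_gt rH)) Hf n).
  apply times_differentiable_mult; [exact Hfn|].
  apply (times_differentiable_comp n _ (fun x => 0 < x) sqrt).
  - intros r Hr; apply Rlt_0_minus, Rlt_div_l; [exact Hl|].
    specialize (Hv r Hr); lra.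
  - apply times_differentiable_sqrt.
  (* The radicand is rewritten into sums and products of constants, [f] and [/ r], to which the
     closure rules apply. *)
  - apply times_differentiable_ext
      with (fun r => 1 + (- / lambda ^ 2) * (f r * (/ r * / r))); [apply open_gt | |].
    + intros r Hr; unfold v; field; split; [lra | intros E; subst; lra].
    + apply times_differentiable_plus; [apply times_differentiable_const|].
      apply times_differentiable_mult; [apply times_differentiable_const|].
      apply times_differentiable_mult; [exact Hfn|].
      assert (Hinv : times_differentiable n (fun r => rH < r) (fun r => / r)).
      { apply (times_differentiable_comp n _ (fun x => 0 < x) Rinv (fun r => r));
          [intros r Hr; lra | apply times_differentiable_inv | apply times_differentiable_id]. }
      apply times_differentiable_mult; exact Hinv.
Qed.

(** Since the extension vanishes at [rH], its difference quotient there is [f r / (r - rH)], which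
    stays below [kappa + 1] close to [rH]. Taking [d / 2] keeps the end point [r1] inside the
    ball. *)
Lemma horizon_linear_bound f rH :
  extends_C3_to_horizon rH f ->
  exists K r1, 0 < K /\ rH < r1 /\ forall r, rH < r <= r1 -> f r <= K * (r - rH).
Proof.
  intros [g [kappa [Hgf [_ [Hg0 [Hd Hk]]]]]].
  destruct (proj1 (filterlim_locally _ kappa) Hd (mkposreal 1 Rlt_0_1)) as [d H].
  pose proof (cond_pos d).
  exists (kappa + 1), (rH + d / 2); split; [lra | split; [lra|]].
  intros r Hr; rewrite <- Hgf by lra.
  assert (Hb : Rabs ((g r - g rH) / (r - rH) - kappa) < 1).
  { apply H; [|lra]; apply Rabs_def1; unfold minus, plus, opp; simpl; lra. }
  apply Rabs_def2 in Hb; rewrite Hg0 in Hb.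
  apply Rle_div_l; [lra|]; replace (g r - 0) with (g r) in Hb by ring; lra.
Qed.

(** Squaring removes the sign [e]. Smoothness is bootstrapped from the signed equation, which
    expresses the derivative as a smooth function of [r]. *)
Lemma signed_speed_global_solution f rH lambda e r :
  0 <= rH -> 0 < lambda ^ 2 -> smooth_on (fun r => rH < r) f ->
  (forall r, rH < r -> v f r < lambda ^ 2) -> e ^ 2 = 1 ->
  (forall t, rH < r t /\ is_derive r t (e * photon_speed f lambda (r t))) ->
  smooth_global_solution f rH lambda r.
Proof.
  intros HrH Hl Hf Hv He Hr; split.
  - intros t _; destruct (Hr t) as [H1 H2]; split; [exact H1|]; split; [eexists; exact H2|].
    rewrite (is_derive_unique _ _ _ H2), Rpow_mult_distr, He, Rmult_1_l.
    apply photon_speed_sqr; [lra | apply Hv, H1 | exact Hl].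
  - apply smooth_on_iff; [exact open_true|]; intros n.
    apply times_differentiable_ODE
      with (fun r => rH < r) (fun x => e * photon_speed f lambda x).
    + intros k; apply times_differentiable_mult; [apply times_differentiable_const|].
      now apply photon_speed_times_differentiable.
    + intros t _; apply Hr.
Qed.

Lemma smooth_global_solution_C1 f rH lambda r a b :
  smooth_global_solution f rH lambda r -> C1_solution f rH lambda (open_interval a b) r.
Proof.
  intros [H1 H2]; split; [now intros t _; apply H1|].
  (* Order 2 says that [Derive r] is itself differentiable, hence continuous. *)
  intros t _; apply (ex_derive_continuous (V := R_NormedModule)); exact (H2 2%nat t I).
Qed.

(* r' never vanishes, so by continuity it has one sign on the whole interval. *)
Lemma C1_solution_signed_speed f rH lambda a b r t0 :
  0 <= rH -> 0 < lambda ^ 2 -> (forall r, rH < r -> 0 < f r) ->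
  (forall r, rH < r -> v f r < lambda ^ 2) ->
  open_interval a b t0 -> C1_solution f rH lambda (open_interval a b) r ->
  exists e, (e = 1 \/ e = -1) /\
    forall t, open_interval a b t ->
      rH < r t /\ is_derive r t (e * photon_speed f lambda (r t)).
Proof.
  intros HrH Hl Hf Hv Ht0 [Hsol Hcont].
  assert (Hsqr : forall t, open_interval a b t ->
            0 < photon_speed f lambda (r t) /\
            Derive r t ^ 2 = photon_speed f lambda (r t) ^ 2).
  { intros t Ht; destruct (Hsol t Ht) as [H1 [_ H3]].
    specialize (Hf _ H1); specialize (Hv _ H1).
    rewrite photon_speed_sqr by lra.
    split; [now apply photon_speed_pos | exact H3]. }
  assert (Hnz : forall t, open_interval a b t -> Derive r t <> 0).
  { intros t Ht E; destruct (Hsqr t Ht) as [H1 H2]; rewrite E in H2; nra. }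
  (* The sign at [t0] decides [e]; with the sign known everywhere, equality of squares determines
     [Derive r t]. *)
  destruct (Rtotal_order (Derive r t0) 0) as [H0|[H0|H0]].
  - exists (-1); split; [now right|]; intros t Ht.
    destruct (Hsol t Ht) as [H1 [H2 _]], (Hsqr t Ht) as [H3 H4].
    split; [exact H1|].
    assert (0 < - Derive r t).
    { apply (no_sign_change a b (fun t => - Derive r t)) with t0; try assumption; [| |lra].
      - intros s Hs; apply (continuous_opp (V := R_NormedModule)), Hcont, Hs.
      - intros s Hs E; apply (Hnz s Hs); lra. }
    replace (-1 * photon_speed f lambda (r t)) with (Derive r t) by nra.
    now apply Derive_correct.
  - now destruct (Hnz t0 Ht0).
  - exists 1; split; [now left|]; intros t Ht.
    destruct (Hsol t Ht) as [H1 [H2 _]], (Hsqr t Ht) as [H3 H4].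
    split; [exact H1|].
    assert (0 < Derive r t).
    { apply (no_sign_change a b (Derive r)) with t0; assumption. }
    replace (1 * photon_speed f lambda (r t)) with (Derive r t) by nra.
    now apply Derive_correct.
Qed.

(** The time is written [t + - t0] so that both solutions are convertible with time-translates by
    [- t0]. *)
Lemma precisely_two_solutions_inverse_time_map f rH lambda G rho t0 c :
  0 <= rH -> 0 < lambda ^ 2 -> smooth_on (fun r => rH < r) f ->
  (forall r, rH < r -> 0 < f r) ->
  (forall r, rH < r -> v f r < lambda ^ 2) ->
  time_map (photon_speed f lambda) rH G ->
  (forall t, rH < rho t) -> (forall t, G (rho t) = t) ->
  (forall r, rH < r -> rho (G r) = r) ->
  (forall t, is_derive rho t (photon_speed f lambda (rho t))) ->
  precisely_two_solutions f rH lambda t0 (rho c)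
    (fun t => rho (t + - t0 + c)) (fun t => rho (- (t + - t0) + c)).
Proof.
  intros HrH Hl Hfs Hf Hv HG Hrho HGrho HrhoG Hd.
  assert (Huniq : forall (a b : Rbar) r, open_interval a b t0 ->
     C1_solution f rH lambda (open_interval a b) r -> r t0 = rho c ->
     (forall t, open_interval a b t -> r t = rho (t + - t0 + c)) \/
     (forall t, open_interval a b t -> r t = rho (- (t + - t0) + c))).
  { intros a b r Ht0 Hr E.
    destruct (C1_solution_signed_speed f rH lambda a b r t0) as [e [He Hre]]; try assumption.
    assert (H := autonomous_solution_unique (photon_speed f lambda) rH G rho a b e r t0 c
                   (fun x Hx => photon_speed_pos f lambda x (Hf x Hx) (Hv x Hx) Hl)
                   HG HrhoG HGrho Ht0 Hre E).
    destruct He as [He|He]; subst e; [left|right]; intros t Ht;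
      rewrite (H t Ht); f_equal; ring. }
  split; [split | split; [split | split; [|split; [|exact Huniq]]]].
  - apply (signed_speed_global_solution f rH lambda 1); try assumption; [ring|].
    intros t; split; [apply Hrho|].
    refine (is_derive_comp rho (fun t => t + - t0 + c) t _ 1 (Hd _) _).
    auto_derive; [easy | ring].
  - f_equal; ring.
  - apply (signed_speed_global_solution f rH lambda (-1)); try assumption; [ring|].
    intros t; split; [apply Hrho|].
    refine (is_derive_comp rho (fun t => - (t + - t0) + c) t _ (-1) (Hd _) _).
    auto_derive; [easy | ring].
  - f_equal; ring.
  (* One unit after [t0] the time map takes the values [1 + c] and [-1 + c] on the two solutions. *)
  - exists (t0 + 1); intros E; apply (f_equal G) in E; rewrite !HGrho in E; lra.
  - intros r Hr E.
    (* Global uniqueness is local uniqueness on the interval from [m_infty] to [p_infty]. *)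
    destruct (Huniq m_infty p_infty r) as [H|H]; [easy | | exact E | |].
    + now apply smooth_global_solution_C1.
    + left; intros t; now apply H.
    + right; intros t; now apply H.
Qed.

(** * Limits at both ends of time *)

(** A value close to [rH], or a large one, is attained at some time [s]; monotonicity extends the
    bound to all times before, or after, [s]. *)
Lemma increasing_onto_ray_limits rH g :
  strictly_increasing_on whole_line g -> (forall t, rH < g t) ->
  (forall y, rH < y -> exists t, g t = y) ->
  is_lim g m_infty rH /\ is_lim g p_infty p_infty.
Proof.
  intros Hincr Hg Honto; split; apply is_lim_spec.
  - intros eps; pose proof (cond_pos eps).
    destruct (Honto (rH + eps)) as [s Hs]; [lra|].
    exists s; intros t Ht; specialize (Hincr t s I I Ht); specialize (Hg t).
    apply Rabs_def1; lra.
  - intros M; destruct (Honto (Rmax M (rH + 1))) as [s Hs].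
    { pose proof (Rmax_r M (rH + 1)); lra. }
    exists s; intros t Ht; specialize (Hincr s t I I Ht).
    pose proof (Rmax_l M (rH + 1)); lra.
Qed.

Lemma is_lim_time_reflect_p_infty g (l : Rbar) :
  is_lim g m_infty l -> is_lim (fun t => g (- t)) p_infty l.
Proof.
  intros H P HP; destruct (H P HP) as [M HM].
  exists (- M); intros t Ht; apply HM; lra.
Qed.

Lemma is_lim_time_reflect_m_infty g (l : Rbar) :
  is_lim g p_infty l -> is_lim (fun t => g (- t)) m_infty l.
Proof.
  intros H P HP; destruct (H P HP) as [M HM].
  exists (- M); intros t Ht; apply HM; lra.
Qed.

Theorem theorem3p10 (f : R -> R) (rH rstar lambda : R)
    (hf : class_S_ext rH rstar f) (hlambda : v f rstar < lambda ^ 2) :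
  exists rlam : R -> R,
    smooth_global_solution f rH lambda rlam /\
    strictly_increasing_on whole_line rlam /\
    (forall y, (exists t, rlam t = y) <-> rH < y) /\
    forall r0, rH < r0 ->
      exists rp rm : R -> R,
        precisely_two_solutions f rH lambda 0 r0 rp rm /\
        (forall t, rm t = time_reflect rp t) /\
        (exists c, forall t, rp t = time_translate rlam c t) /\
        (forall t0, precisely_two_solutions f rH lambda t0 r0
                      (time_translate rp (- t0)) (time_translate rm (- t0))) /\
        strictly_increasing_on whole_line rp /\
        is_lim rp m_infty rH /\ is_lim rp p_infty p_infty /\
        strictly_decreasing_on whole_line rm /\
        is_lim rm m_infty p_infty /\ is_lim rm p_infty rH.
Proof.
  destruct hf as [HrH [[_ [_ [Hsm Hfpos]]] [Hext [Hlim [_ [Hstar [_ [Hmax _]]]]]]]].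
  assert (Hf : forall r, rH < r -> 0 < f r) by (intros r Hr; apply Hfpos; now split).
  assert (Hfs : smooth_on (fun r => rH < r) f) by (intros k r Hr; apply Hsm; now split).
  assert (Hv : forall r, rH < r -> v f r < lambda ^ 2).
  { intros r Hr; destruct (Req_dec r rstar) as [->|Hn]; [exact hlambda|].
    specialize (Hmax r Hr Hn); lra. }
  assert (Hl : 0 < lambda ^ 2).
  { apply Rlt_trans with (v f rstar); [|exact hlambda].
    apply Rdiv_lt_0_compat; [apply Hf, Hstar | nra]. }
  set (F := photon_speed f lambda).
  assert (Fpos : forall r, rH < r -> 0 < F r).
  { intros r Hr; apply photon_speed_pos; auto. }
  assert (Fle : forall r, rH < r -> F r <= f r).
  { intros r Hr; apply photon_speed_le; [auto | lra | exact Hl]. }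
  assert (Fcont : forall r, rH < r -> continuous F r).
  { destruct (photon_speed_times_differentiable 1 f rH lambda) as [F' [HF _]]; auto; [lra|].
    intros r Hr; apply (ex_derive_continuous (V := R_NormedModule)).
    exists (F' r); exact (HF r Hr). }
  destruct (horizon_linear_bound f rH Hext) as [K [r1 [HK [Hr1 Hnear]]]].
  (* Beyond [M], [f] differs from its limit 1 by less than 1, whence the bound 2; [Rmax M rH] also
     keeps [r] in the domain. *)
  destruct (proj2 (is_lim_spec _ _ _) Hlim (mkposreal 1 Rlt_0_1)) as [M HM].
  destruct (time_map_exists F rH K r1 (Rmax M rH) 2) as [G HG]; try assumption; [| lra | |].
  { intros r Hr; apply Rle_trans with (f r); [apply Fle; lra | now apply Hnear]. }
  { intros r Hr; pose proof (Rmax_l M rH); pose proof (Rmax_r M rH).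
    apply Rle_trans with (f r); [apply Fle; lra|].
    assert (Hb : Rabs (f r - 1) < 1) by (apply HM; lra).
    apply Rabs_def2 in Hb; lra. }
  destruct (time_map_inverse F rH G Fpos Fcont HG) as [rho [Hrho [HGrho [HrhoG Hd]]]].
  assert (Hincr : strictly_increasing_on whole_line rho).
  { intros s t _ _ Hst; destruct (mean_value rho (fun t => F (rho t)) s t) as [c [_ E]].
    - intros x _; apply Hd.
    - specialize (Fpos (rho c) (Hrho c)); nra. }
  exists rho; split; [|split; [exact Hincr | split]].
  - apply (signed_speed_global_solution f rH lambda 1); try assumption; [lra | ring |].
    intros t; rewrite Rmult_1_l; split; [apply Hrho | apply Hd].
  - intros y; split; [intros [t <-]; apply Hrho | intros Hy; exists (G y); auto].
  (* [c] is the time at which [rho] passes through [r0]. *)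
  - intros r0 Hr0; set (c := G r0).
    assert (Htwo : forall t0, precisely_two_solutions f rH lambda t0 r0
              (fun t => rho (t + - t0 + c)) (fun t => rho (- (t + - t0) + c))).
    { intros t0; rewrite <- (HrhoG r0 Hr0).
      apply precisely_two_solutions_inverse_time_map with G; auto; lra. }
    assert (Hincr' : strictly_increasing_on whole_line (fun t => rho (t + c))).
    { intros s t _ _ Hst; apply Hincr; [easy | easy | lra]. }
    destruct (increasing_onto_ray_limits rH (fun t => rho (t + c))) as [Hlm Hlp]; auto.
    { intros y Hy; exists (G y - c); replace (G y - c + c) with (G y) by ring; auto. }
    exists (fun t => rho (t + c)), (fun t => rho (- t + c)).
    split; [|split; [|split; [|split; [|split; [|split; [|split; [|split; [|split]]]]]]]].
    (* The case [t0 = 0] of [Htwo] carries a term [- 0], removed under the binder by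
       extensionality. *)
    + replace (fun t => rho (t + c)) with (fun t => rho (t + - 0 + c))
        by (apply functional_extensionality; intros t; f_equal; ring).
      replace (fun t => rho (- t + c)) with (fun t => rho (- (t + - 0) + c))
        by (apply functional_extensionality; intros t; f_equal; ring).
      apply Htwo.
    + easy.
    + now exists c.
    + exact Htwo.
    + exact Hincr'.
    + exact Hlm.
    + exact Hlp.
    + intros s t _ _ Hst; apply Hincr; [easy | easy | lra].
    + exact (is_lim_time_reflect_m_infty (fun t => rho (t + c)) p_infty Hlp).
    + exact (is_lim_time_reflect_p_infty (fun t => rho (t + c)) rH Hlm).
Qed.
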